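(* Let $k\ge 4$ and $n\ge k+2$ be integers. Then every $k$-critical graph on $n$ vertices contains a cycle of length at least $\frac{\log n}{100\log k}$.
   Context: All graphs are finite and simple. A graph $G$ is $k$-critical if $G$ is not $(k-1)$-colorable but every proper subgraph of $G$ is $(k-1)$-colorable. The length of a cycle is its number of edges. Logarithms are to any fixed base greater than $1$ (the quotient does not depend on the base). *)

(* Defs.v *)
From HB Require Import structures.
From mathcomp Require Import all_boot all_order all_algebra.
From mathcomp Require Import reals exp.

Set Implicit Arguments.
Unset Strict Implicit.
Unset Printing Implicit Defensive.

(* A finite simple graph with vertex set inside the ambient finite type T, so
   that a graph and its subgraphs (which may drop vertices) share one type. *)
Record sgraph (T : finType) := SGraph {
  vset : {set T};
  adj : rel T;
  adj_sym : symmetric adj;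
  adj_irrefl : irreflexive adj;
  adj_vset : forall x y, adj x y -> x \in vset
}.

Definition subgraph (T : finType) (H G : sgraph T) : Prop :=
  vset H \subset vset G /\ subrel (adj H) (adj G).

Definition proper_subgraph (T : finType) (H G : sgraph T) : Prop :=
  subgraph H G /\ ~ subgraph G H.

(* Only the colors of the vertices in vset G are constrained; taking colors in
   nat rather than in 'I_m keeps the empty graph 0-colorable. *)
Definition colorable (T : finType) (m : nat) (G : sgraph T) : Prop :=
  exists c : T -> nat,
    (forall x, x \in vset G -> c x < m) /\
    (forall x y, adj G x y -> c x <> c y).

(* Meaningful for k >= 1, because k.-1 is truncated. *)
Definition critical (T : finType) (k : nat) (G : sgraph T) : Prop :=
  ~ colorable k.-1 G /\
  forall H : sgraph T, proper_subgraph H G -> colorable k.-1 H.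

(* A cycle is listed by its distinct vertices in cyclic order, so its number
   of edges is size s; its vertices lie in vset G by adj_vset. *)
Definition graph_cycle (T : finType) (G : sgraph T) (s : seq T) : Prop :=
  3 <= size s /\ ucycle (adj G) s.

(* Main.v *)
(** Fix an edge uv of a critical graph G and a longest u-v path u Q v with
    nonempty interior Q; with uv it is a cycle of length |Q| + 2.  We show that
    G has treedepth at most 2|Q| + 2, and that a k-critical graph of treedepth h
    has at most k^h vertices.

    Treedepth.  More generally, let D be connected in a 2-connected graph, with
    outer neighbours in A u B, and let Q = q_1 .. q_l be a longest path of D from
    a neighbour of A to a neighbour of B; then D has treedepth at most 2l.  By
    induction it is enough to delete some S from D so that the outer neighbours
    of every component K of D - S can be split into two sides joined through K
    only by paths with at most l - |S|/2 vertices.  If S = Q does not work, then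
    some component K0 of D - Q has, from each of its neighbours in Q, a detour of
    more than l/2 vertices; so all neighbours of K0 lie near the two ends of Q.
    Choose K0 with the least i such that they lie within the first or last i
    positions, say with q_i among them, and let S be these 2i positions.  The
    component K of D - S containing the middle of Q works with sides q_i and the
    rest: a path through K from q_i to the far end has at most l - i vertices
    since Q is longest, and a path from q_i back to an earlier q_j is short, as it
    is continued by the detour through K0.  By the minimality of i, the other
    components have a neighbour q_m not among the first or last i - 1 positions,
    or are split by a vertex of Q as in the case S = Q. *)

Require Import Defs.
From HB Require Import structures.
From mathcomp Require Import all_boot all_order all_algebra.
From mathcomp Require Import reals exp.
From mathcomp Require Import boolp zify.

Set Implicit Arguments.
Unset Strict Implicit.
Unset Printing Implicit Defensive.

(** * Ears and treedepth *)

Section Elimination.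
Context (T : finType) (e : rel T) (e_sym : symmetric e).
Implicit Types (A B D K L S W X Y : {set T}) (s Q : seq T).

Definition no_edge A B := [forall x in A, forall y in B, ~~ e x y].

Lemma no_edgeP A B :
  reflect (forall x y, x \in A -> y \in B -> ~~ e x y) (no_edge A B).
Proof.
apply: (iffP forall_inP) => [h x y xA yB|h x xA].
  by have /forall_inP := h x xA; apply.
by apply/forall_inP => y; apply: h.
Qed.

Lemma no_edgePn A B :
  reflect (exists x y, [/\ x \in A, y \in B & e x y]) (~~ no_edge A B).
Proof.
apply: (iffP idP) => [|[x [y [xA yB exy]]]]; last first.
  by apply/no_edgeP => /(_ x y xA yB); rewrite exy.
rewrite negb_forall_in => /exists_inP[x xA].
rewrite negb_forall_in => /exists_inP[y yB] /negbNE exy.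
by exists x, y.
Qed.

Lemma no_edgeS A A' B B' :
  A' \subset A -> B' \subset B -> no_edge A B -> no_edge A' B'.
Proof.
move=> /subsetP sA /subsetP sB /no_edgeP h; apply/no_edgeP => x y xA yB.
by apply: h; [apply: sA | apply: sB].
Qed.

Definition connected_in D := forall L,
  L \subset D -> L != set0 -> no_edge L (D :\: L) -> L = D.

Definition component K W :=
  [/\ K != set0, K \subset W, no_edge K (W :\: K) & connected_in K].

(** A minimal nonempty subset of [W] without edges to the rest of [W] is connected: a part cut off
    inside it would be cut off in [W] as well. *)
Lemma exists_component W : W != set0 -> exists K, component K W.
Proof.
move=> W0.
pose P := [pred K : {set T} | [&& K != set0, K \subset W & no_edge K (W :\: K)]].
have PW : P W.
  by rewrite /= W0 subxx setDv; apply/no_edgeP => x y _; rewrite inE.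
have [K /minsetP[/and3P[K0 sKW nK] Kmin] _] := minset_exists PW.
exists K; split=> // L sLK L0 nL; apply: Kmin => //=.
rewrite L0 (subset_trans sLK sKW) /=; apply/no_edgeP => x y xL.
rewrite inE => /andP[yL yW]; have [yK|yK] := boolP (y \in K).
  by apply: (no_edgeP _ _ nL) => //; rewrite inE yL.
by apply: (no_edgeP _ _ nK); [exact: subsetP xL | rewrite inE yK].
Qed.

Lemma component_closed K W x y :
  component K W -> x \in K -> y \in W -> e x y -> y \in K.
Proof.
case=> _ _ /no_edgeP nK _ xK yW; apply: contraTT => yK.
by apply: nK => //; rewrite inE yK.
Qed.

Lemma component_setD K K' W :
  component K W -> component K' (W :\: K) -> component K' W.
Proof.
move=> [_ sK nK _] [K'0 sK' nK' cK']; split=> //.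
  exact: subset_trans sK' (subsetDl _ _).
apply/no_edgeP => x y xK'; rewrite inE => /andP[yK' yW].
have [yK|yK] := boolP (y \in K).
  rewrite e_sym; apply: (no_edgeP _ _ nK) => //; exact: subsetP sK' _ xK'.
by apply: (no_edgeP _ _ nK') => //; rewrite !inE yK' yK.
Qed.

Lemma connected_path D x y : connected_in D -> x \in D -> y \in D ->
  exists p, [/\ path e x p, last x p = y, uniq (x :: p) &
                {subset x :: p <= D}].
Proof.
move=> cD xD yD.
pose r := [rel u v | e u v && (v \in D)].
pose L := [set z in D | connect r x z].
have LD : L = D.
  apply: cD; first by apply/subsetP => z; rewrite inE => /andP[].
    by apply/set0Pn; exists x; rewrite inE xD connect0.
  apply/no_edgeP => u v; rewrite !inE => /andP[uD xu].
  rewrite negb_and andbC => /andP[vD]; rewrite vD /=; apply: contra => euv.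
  by apply: connect_trans xu (connect1 _); rewrite /= euv.
move: yD; rewrite -{1}LD inE => /andP[_ /connectP[p rp ->]].
case/shortenP: rp => p' rp' up' _; exists p'; split=> //.
  by apply: sub_path rp' => u v /andP[].
move=> z; rewrite inE => /orP[/eqP->//|].
elim: p' x rp' {up' xD L LD} => //= v p' IH x /andP[/andP[_ vD] rp'].
by rewrite inE => /orP[/eqP->//|]; apply: IH rp'.
Qed.

(** An upper bound on treedepth: the union rule stands for the maximum over components, and each
    removed vertex costs one level. *)
Inductive treedepth_le : {set T} -> nat -> Prop :=
| treedepth0 h : treedepth_le set0 h
| treedepthU D1 D2 h : [disjoint D1 & D2] -> no_edge D1 D2 ->
    treedepth_le D1 h -> treedepth_le D2 h -> treedepth_le (D1 :|: D2) h
| treedepthS x D h : x \in D ->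
    treedepth_le (D :\ x) h -> treedepth_le D h.+1.

Lemma treedepthW D h h' : h <= h' -> treedepth_le D h -> treedepth_le D h'.
Proof.
move=> le_hh' t; elim: t h' le_hh' => {D h}
    [h h' _|D1 D2 h dis nE _ IH1 _ IH2 h' le|x D h xD _ IH [|h'] le].
- exact: treedepth0.
- by apply: treedepthU; [| |apply: IH1|apply: IH2].
- by [].
- by apply: treedepthS xD _; apply: IH.
Qed.

Lemma treedepthD D S h :
  S \subset D -> treedepth_le (D :\: S) h -> treedepth_le D (h + #|S|).
Proof.
have [n] := ubnP #|S|; elim: n => // n IH in D S *.
have [->|[x xS]] := set_0Vmem S; first by rewrite cards0 addn0 setD0.
rewrite (cardsD1 x) xS ltnS addnCA add1n => leSn sSD t.
apply: (@treedepthS x); first exact: subsetP xS.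
apply: IH => //; first exact: setSD.
suff -> : (D :\ x) :\: (S :\ x) = D :\: S by [].
apply/setP => y; rewrite !inE; case: eqP => [->|]; last by [].
by rewrite xS.
Qed.

Lemma treedepth_components W h :
  (forall K, component K W -> treedepth_le K h) -> treedepth_le W h.
Proof.
have [n] := ubnP #|W|; elim: n => // n IH in W *; rewrite ltnS => leWn tW.
have [->|W0] := eqVneq W set0; first exact: treedepth0.
have [K cK] := exists_component W0; have [K0 sKW nK _] := cK.
have -> : W = K :|: (W :\: K) by rewrite -{1}(setID W K) (setIidPr sKW).
apply: treedepthU => //; first by rewrite disjoint_sym disjoints_subset setDE subsetIr.
  exact: tW.
apply: IH => [|K' cK']; last by apply: tW; apply: component_setD cK'.
apply: leq_trans leWn; apply: proper_card; rewrite properEneq subsetDl andbT.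
apply: contraNneq K0 => /setP eqW; rewrite -subset0; apply/subsetP => x xK.
by have := eqW x; rewrite !inE xK (subsetP sKW x xK).
Qed.

(** [s] lists only the interior of the path; an empty [s] stands for an edge between [X] and [Y]. *)
Definition ear X Y D s :=
  [/\ uniq s, {subset s <= D} &
      exists x y, [/\ x \in X, y \in Y & path e x (rcons s y)]].

Lemma earS X X' Y Y' D D' s : X \subset X' -> Y \subset Y' -> D \subset D' ->
  ear X Y D s -> ear X' Y' D' s.
Proof.
move=> /subsetP sX /subsetP sY /subsetP sD [us ss [x [y [xX yY p]]]].
by split=> // [z /ss/sD //|]; exists x, y; split; auto.
Qed.

Lemma ear_rev X Y D s : ear X Y D s -> ear Y X D (rev s).
Proof.
case=> us ss [x [y [xX yY p]]]; split.
- by rewrite rev_uniq.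
- by move=> z; rewrite mem_rev; apply: ss.
exists y, x; split=> //; rewrite -rev_cons.
have := rev_path e x (rcons s y); rewrite last_rcons.
rewrite belast_rcons => ->.
by apply: sub_path p => u v; rewrite /= e_sym.
Qed.

Lemma ear_cat X Y D1 D2 q s1 s2 :
  ear X [set q] D1 s1 -> ear [set q] Y D2 s2 ->
  [disjoint D1 & D2] -> q \notin D1 -> q \notin D2 ->
  ear X Y (D1 :|: (q |: D2)) (s1 ++ q :: s2).
Proof.
move=> [us1 ss1 [x [_ [xX /set1P-> p1]]]] [us2 ss2 [_ [y [/set1P-> yY p2]]]].
move=> dis q1 q2; split.
- rewrite cat_uniq us1 /= us2 (contra (ss2 q)) // !andbT negb_or.
  rewrite (contra (ss1 q)) //=; apply/hasPn => z /ss2 z2.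
  apply/negP => /ss1 z1.
  by have := disjointFr dis z1; rewrite z2.
- move=> z; rewrite mem_cat !inE => /orP[/ss1->//|/orP[->|/ss2->]];
    by rewrite ?orbT.
exists x, y; split=> //; rewrite rcons_cat cat_path /=.
by move: p1; rewrite rcons_path => /andP[-> ->].
Qed.

End Elimination.

(** * Positions on a longest ear *)

Section Positions.
Context (T : finType) (e : rel T) (e_sym : symmetric e).
Implicit Types (A B D K L S W X Y : {set T}) (s Q : seq T).

(* Stop 0 is [A], stop [j] is the [j]-th vertex of [Q] counted from 1, and all
   later stops are [B]. *)
Definition stop A B Q j := nth B (A :: [seq [set x] | x <- Q]) j.

(* Positions are also counted from 1. *)
Definition positions Q (P : pred nat) := [set x in Q | P (index x Q).+1].

Lemma stop_last A B Q : stop A B Q (size Q).+1 = B.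
Proof. by rewrite /stop nth_default //= size_map. Qed.

Lemma stop_nth A B Q x0 j : j < size Q -> stop A B Q j.+1 = [set nth x0 Q j].
Proof. by move=> lt_jQ; rewrite /stop /= (nth_map x0). Qed.

Lemma stop_position A B Q j : 0 < j <= size Q -> exists2 q,
  stop A B Q j = [set q] & q \in Q /\ (uniq Q -> index q Q = j.-1).
Proof.
case: j => // j /= lt_jQ; have [x0 _] : exists x0 : T, True.
  by case: Q lt_jQ => // x0; exists x0.
exists (nth x0 Q j); first exact: stop_nth.
by split; [apply: mem_nth | move=> uQ; rewrite index_uniq].
Qed.

Lemma stop_rev A B Q j : j <= (size Q).+1 ->
  stop B A (rev Q) j = stop A B Q ((size Q).+1 - j).
Proof.
(* With the final side as a last entry instead of a default value, the list of stops can be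
   reversed. *)
have stopE A' B' Q' i : stop A' B' Q' i =
    nth B' (A' :: rcons [seq [set x] | x <- Q'] B') i.
  case: i => //= i; rewrite /stop /= nth_rcons size_map.
  by case: ltngtP => // [?|->]; rewrite ?nth_default // size_map // ltnW.
move=> le_jQ; rewrite !stopE map_rev -rev_cons -rcons_cons -rev_rcons rcons_cons.
rewrite nth_rev /= !size_rcons !size_map //.
by apply: set_nth_default; rewrite /= size_rcons size_map; lia.
Qed.

Lemma positionsS Q (P P' : pred nat) :
  (forall m, P m -> P' m) -> positions Q P \subset positions Q P'.
Proof.
by move=> h; apply/subsetP => x; rewrite !inE => /andP[-> /h].
Qed.

Lemma positions_disjoint Q (P P' : pred nat) :
  (forall m, P m -> ~~ P' m) -> [disjoint positions Q P & positions Q P'].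
Proof.
move=> h; rewrite disjoints_subset; apply/subsetP => x.
by rewrite !inE => /andP[-> /h].
Qed.

Lemma ear_segment A B D Q j l : ear e A B D Q -> j < l <= (size Q).+1 ->
  exists2 s, ear e (stop A B Q j) (stop A B Q l)
                 (positions Q (fun m => j < m < l)) s & size s = (l - j).-1.
Proof.
move=> [uQ _ [a [b [aA bB pQ]]]] /andP[lt_jl le_lQ].
pose F := a :: rcons Q b.
have sF : size F = (size Q).+2 by rewrite /= size_rcons.
have F_stop i : i <= (size Q).+1 -> nth a F i \in stop A B Q i.
  case: i => [|i] //= le_iQ; rewrite nth_rcons; case: ltngtP => [lt_iQ|lt_Qi|->].
  - by rewrite (stop_nth _ _ a) // set11.
  - lia.
  - by rewrite stop_last.
pose s := take (l - j).-1 (drop j Q).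
have ss : size s = (l - j).-1 by rewrite size_takel // size_drop; lia.
exists s => //; split; first by rewrite take_uniq // drop_uniq.
- move=> x xs; have xQ : x \in Q by exact: mem_drop (mem_take xs).
  rewrite inE xQ /=.
  have lt_i : index x s < (l - j).-1 by rewrite -ss index_mem.
  have -> : index x Q = j + index x s; last by lia.
  rewrite -{1}(nth_index a xs) nth_take // nth_drop index_uniq //.
  move: (index x s) lt_i (size Q) le_lQ => i lt_i n le_n; clear - lt_i le_n lt_jl; lia.
exists (nth a F j), (nth a F l); split; try by apply: F_stop; lia.
apply/(pathP a) => i; rewrite size_rcons ss => lt_i.
have F_s k : k <= (l - j).-1 -> nth a (rcons s (nth a F l)) k = nth a F (j + k).+1.
  move=> le_k; rewrite nth_rcons ss; case: ltngtP => [lt_k|lt_k|eq_k].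
  - rewrite nth_take // nth_drop /= nth_rcons ifT //; lia.
  - lia.
  - by rewrite eq_k; congr nth; lia.
have -> : nth a (nth a F j :: rcons s (nth a F l)) i = nth a F (j + i).
  by case: i lt_i => [|i] lt_i; rewrite ?addn0 // [LHS]F_s ?addnS //; lia.
rewrite F_s; last by lia.
apply: (elimT (pathP a) pQ); rewrite size_rcons; lia.
Qed.

Lemma ear_extend_left A B D Q j Y K s : ear e A B D Q -> j <= size Q ->
  ear e (stop A B Q j) Y K s -> [disjoint K & positions Q (fun m => m <= j)] ->
  exists2 s', ear e A Y (K :|: positions Q (fun m => m <= j)) s'
            & size s' = size s + j.
Proof.
move=> eQ; case: (posnP j) => [->|j0] le_jQ es dis.
  by exists s; rewrite ?addn0 //; apply: earS es => //; apply: subsetUl.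
have [uQ _ _] := eQ.
have [|t et st] := ear_segment (j := 0) (l := j) eQ; first by lia.
have [|q Gq [qQ /(_ uQ) iq]] := stop_position (Q := Q) (j := j) A B; first by lia.
rewrite Gq in es et; exists (t ++ q :: s); last by rewrite size_cat /= st; lia.
have qj : q \in positions Q (fun m => m <= j) by rewrite inE qQ iq; lia.
have sub := @positionsS Q (fun m => 0 < m < j) (fun m => m <= j).
apply: earS (subxx _) (subxx _) _ (ear_cat et es _ _ _).
- rewrite !subUset subsetUl andbT sub1set inE qj orbT andbT.
  by apply: subset_trans (sub _) (subsetUr _ _) => m; lia.
- rewrite disjoint_sym; apply: disjointWr dis; apply: sub => m; lia.
- by rewrite inE qQ iq /=; lia.
- by rewrite (disjointFl dis qj).
Qed.

Lemma ear_extend_right A B D Q l X K s : ear e A B D Q ->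
  0 < l <= (size Q).+1 -> ear e X (stop A B Q l) K s ->
  [disjoint K & positions Q (fun m => l <= m)] ->
  exists2 s', ear e X B (K :|: positions Q (fun m => l <= m)) s'
            & size s' = size s + ((size Q).+1 - l).
Proof.
move=> eQ /andP[l0]; rewrite leq_eqVlt => /orP[/eqP->|lt_lQ] es dis.
  exists s; last by lia.
  by apply: earS es => //; rewrite ?stop_last ?subsetUl.
have [uQ _ _] := eQ.
have [|t et st] := ear_segment (j := l) (l := (size Q).+1) eQ; first by lia.
have [|q Gq [qQ /(_ uQ) iq]] := stop_position (Q := Q) (j := l) A B; first by lia.
move: et es; rewrite Gq stop_last => et es.
exists (s ++ q :: t); last by rewrite size_cat /= st; lia.
have ql : q \in positions Q (fun m => l <= m) by rewrite inE qQ iq; lia.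
have sub := @positionsS Q (fun m => l < m < (size Q).+1) (fun m => l <= m).
apply: earS (subxx _) (subxx _) _ (ear_cat es et _ _ _).
- rewrite !subUset subsetUl /= sub1set inE ql orbT /=.
  by apply: subset_trans (sub _) (subsetUr _ _) => m; lia.
- apply: disjointWr dis; apply: sub => m; lia.
- by rewrite (disjointFl dis ql).
- by rewrite inE qQ iq /=; lia.
Qed.

(** Replacing the stretch of [Q] strictly between stops [j] and [l] by [s] gives an ear with
    [j + size s + ((size Q).+1 - l)] vertices, which is at most [size Q]. *)
Lemma longest_splice A B D Q j l K s : ear e A B D Q ->
  (forall s', ear e A B D s' -> size s' <= size Q) ->
  j < l <= (size Q).+1 -> K \subset D ->
  [disjoint K & positions Q (fun m => (m <= j) || (l <= m))] ->
  ear e (stop A B Q j) (stop A B Q l) K s -> size s + j < l.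
Proof.
move=> eQ maxQ /andP[lt_jl le_lQ] sKD dis es.
have [_ sQ _] := eQ.
have QD P : positions Q P \subset D by apply/subsetP => x; rewrite inE => /andP[/sQ].
have [||t et st] := ear_extend_left eQ _ es; [by lia | |].
  by apply: disjointWr dis; apply: positionsS => m ->.
have [||u eu su] := ear_extend_right eQ _ et; [by lia | |].
  rewrite -setI_eq0 setIUl setU_eq0 !setI_eq0; apply/andP; split.
    by apply: disjointWr dis; apply: positionsS => m ->; rewrite orbT.
  by apply: positions_disjoint => m; lia.
suff : size u <= size Q by lia.
by apply/maxQ; apply: earS eu => //; rewrite !subUset sKD !QD.
Qed.

End Positions.

(** * Treedepth and longest ears *)

Section Pieces.
Context (T : finType) (e : rel T) (e_sym : symmetric e).
Context (V : {set T}) (eV : forall x y, e x y -> x \in V).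
Implicit Types (A B D K L S W X Y : {set T}) (s Q : seq T).

(** The absence of a cut vertex, expressed through a union [K] of components left after deleting
    [z]. *)
Definition two_connected := forall K z,
  K \subset V -> K != set0 -> z \in V -> z \notin K ->
  no_edge e K (V :\: (z |: K)) -> V \subset z |: K.

(** The object of the induction: a connected part whose outer neighbours are divided between two
    sides, both of them met. The sides may overlap. *)
Record piece D A B : Prop := Piece {
  piece_subV : D \subset V;
  piece_connected : connected_in e D;
  piece_disjoint : [disjoint D & A :|: B];
  piece_boundary : no_edge e D (V :\: (D :|: (A :|: B)));
  piece_left : ~~ no_edge e D A;
  piece_right : ~~ no_edge e D B }.

Definition smaller_pieces_bounded D := forall K A B n,
  piece K A B -> #|K| < #|D| ->
  (forall s, ear e A B K s -> size s <= n) -> treedepth_le e K (2 * n).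

(** The stops that can contain outer neighbours once the positions in [I] are deleted: the two outer
    sides and the deleted vertices. *)
Definition kept Q (I : pred nat) j := [|| j == 0, j == (size Q).+1 | I j].

Definition attached A B Q K j := ~~ no_edge e K (stop A B Q j).

Lemma kept_stopP A B Q I z : uniq Q ->
  reflect (exists l, [/\ l <= (size Q).+1, kept Q I l & z \in stop A B Q l])
          (z \in (A :|: B) :|: positions Q I).
Proof.
move=> uQ; apply: (iffP idP) => [|[l [le_lQ]]].
  rewrite !inE => /orP[/orP[zA|zB]|/andP[zQ Iz]].
  - by exists 0.
  - by exists (size Q).+1; rewrite stop_last /kept eqxx orbT.
  - exists (index z Q).+1; rewrite ltnS index_size (stop_nth _ _ z) ?index_mem //.
    by rewrite nth_index // set11 /kept Iz !orbT.
have [->|l0] := posnP l; first by rewrite /stop /= !inE => _ ->.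
have [->|ne_lQ] := eqVneq l (size Q).+1.
  by rewrite stop_last !inE => _ ->; rewrite orbT.
have [|q -> [qQ /(_ uQ) iq]] := @stop_position T A B Q l; first by lia.
rewrite /kept (negPf ne_lQ) !inE; case: (l =P 0) => [|_ /= Il /eqP->]; first by lia.
by rewrite qQ iq prednK // Il orbT.
Qed.

(** The main point is that [K] meets the kept stops other than [m]. If all its outer neighbours were
    in stop [m], then either this is an outer side, and [K] is cut off in [D] and equals [D]
    although a vertex was deleted, or it is a cut vertex separating [K] from a neighbour of [D] in
    [A]. *)
Lemma piece_component A B D Q I K m : two_connected ->
  piece D A B -> ear e A B D Q -> positions Q I != set0 ->
  component e K (D :\: positions Q I) ->
  m <= (size Q).+1 -> kept Q I m -> attached A B Q K m ->
  piece K (stop A B Q m)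
    (\bigcup_(l < (size Q).+2 | kept Q I l && (l != m :> nat)) stop A B Q l).
Proof.
set S := positions Q I; set B' := \bigcup_(l < _ | _) _.
move=> tc [sDV cD disD bD aA aB] [uQ sQ _] S0 cK le_m km am.
have [K0 sKW nK conK] := cK.
have sSD : S \subset D by apply/subsetP => x; rewrite inE => /andP[/sQ].
have sKD : K \subset D := subset_trans sKW (subsetDl _ _).
have KS x : x \in K -> x \notin S by move=> /(subsetP sKW); rewrite inE => /andP[].
have coverE : stop A B Q m :|: B' = (A :|: B) :|: S.
  apply/setP => z; rewrite inE; apply/idP/(kept_stopP A B I z uQ).
    case/orP=> [zm|/bigcupP[l /andP[kl _] zl]]; first by exists m.
    by exists l; rewrite -ltnS.
  move=> [l [le_l kl zl]]; have [<-|ne_lm] := eqVneq l m; first by rewrite zl.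
  apply/orP; right; apply/bigcupP; rewrite -ltnS in le_l.
  by exists (Ordinal le_l); rewrite //= kl.
have boundK x y : x \in K -> y \in V -> e x y -> y \notin K -> y \in (A :|: B) :|: S.
  move=> xK yV exy yK; rewrite inE; apply/orP.
  have [yD|yD] := boolP (y \in D).
    right; apply: contraNT yK => yS; apply: component_closed cK xK _ exy.
    by rewrite inE yS.
  left; apply: contraTT exy => yAB; apply: (no_edgeP _ _ _ bD).
    exact: subsetP sKD x xK.
  by rewrite !inE (negPf yD) yV /= andbT -in_setU.
split=> //.
- exact: subset_trans sKD sDV.
- rewrite coverE disjoints_subset; apply/subsetP => x xK.
  have := disjointFr disD (subsetP sKD x xK); rewrite !inE => ->.
  by have := KS x xK; rewrite /S inE.
- rewrite coverE; apply/no_edgeP => x y xK; rewrite inE => /andP[yK yV].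
  apply: contraNN yK => exy; rewrite inE; have [//|yK /=] := boolP (y \in K).
  exact: boundK exy yK.
apply/negP => nB'.
have onlym x y : x \in K -> y \in V -> e x y -> y \notin K -> y \in stop A B Q m.
  move=> xK yV exy yK; have := boundK _ _ xK yV exy yK.
  rewrite -coverE inE => /orP[//|yB'].
  by have := no_edgeP _ _ _ nB' x y xK yB'; rewrite exy.
have notD : D != K.
  have /set0Pn[x xS] := S0; apply: contraTneq (xS) => eqDK.
  by apply: KS; rewrite -eqDK (subsetP sSD).
have noAB : stop A B Q m \subset A :|: B -> False.
  move=> sAB; move/eqP: notD; apply; apply/esym/cD => //.
  apply/no_edgeP => x y xK; rewrite inE => /andP[yK yD]; apply/negP => exy.
  have /(subsetP sAB) yAB := onlym x y xK (subsetP sDV y yD) exy yK.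
  by have := disjointFr disD yD; rewrite yAB.
have [m0|m0] := posnP m; first by apply: noAB; rewrite m0 subsetUl.
have [mQ|mQ] := eqVneq m (size Q).+1.
  by apply: noAB; rewrite mQ stop_last subsetUr.
have [|q Gq [qQ _]] := @stop_position T A B Q m.
  by rewrite m0 -ltnS ltn_neqAle mQ.
have [x [a [xD aA' exa]]] := no_edgePn _ _ _ aA.
have aV : a \in V by apply: (eV (y := x)); rewrite e_sym.
have aD : a \notin D.
  by apply/negP => aD; have := disjointFr disD aD; rewrite inE aA'.
have qS : q \in S.
  have := kept_stopP A B I q uQ; rewrite inE -/S => /introT h.
  have : q \in A :|: B :|: S.
    by rewrite inE; apply: h; exists m; rewrite Gq set11.
  rewrite inE => /orP[qAB|//].
  by have := disjointFr disD (sQ q qQ); rewrite qAB.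
have qK : q \notin K by apply/negP => /KS; rewrite qS.
have sVqK : V \subset q |: K.
  apply: tc => //; [exact: subset_trans sKD sDV | exact: subsetP sDV q (sQ q qQ) |].
  apply/no_edgeP => u v uK; rewrite inE => /andP[vqK vV].
  apply: contraNN vqK => euv; rewrite in_setU1.
  have [_|vK] := boolP (v \in K); first by rewrite orbT.
  by have := onlym u v uK vV euv vK; rewrite Gq inE => ->.
have := subsetP sVqK a aV.
rewrite !inE => /orP[/eqP aq|/(subsetP sKD)]; last by rewrite (negPf aD).
by rewrite aq sQ in aD.
Qed.

(** Ears inside a component have at most [size Q - uphalf c] vertices, so the induction hypothesis
    bounds its treedepth by [2 * size Q - c]; the deleted vertices add at most [c]. *)
Lemma elimination_step A B D Q I c : two_connected ->
  piece D A B -> ear e A B D Q -> positions Q I != set0 ->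
  #|positions Q I| <= c -> c <= 2 * size Q -> smaller_pieces_bounded D ->
  (forall K, component e K (D :\: positions Q I) -> exists m,
    [/\ m <= (size Q).+1, kept Q I m, attached A B Q K m &
      forall l s, l <= (size Q).+1 -> kept Q I l -> l != m ->
        ear e (stop A B Q m) (stop A B Q l) K s ->
        2 * size s + c <= 2 * size Q]) ->
  treedepth_le e D (2 * size Q).
Proof.
move=> tc pD eQ S0 le_Sc le_cQ IH good.
have [uQ sQ _] := eQ.
have sSD : positions Q I \subset D by apply/subsetP => x; rewrite inE => /andP[/sQ].
apply: (@treedepthW _ _ _ ((2 * size Q - c) + #|positions Q I|)); first by lia.
apply: treedepthD => //; apply: treedepth_components => // K cK.
have [m [le_m km am short]] := good K cK.
apply: (@treedepthW _ _ _ (2 * (size Q - uphalf c))); first by lia.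
apply: IH (piece_component tc pD eQ S0 cK le_m km am) _ _ => [|s].
  have [_ /subset_leq_card le_K _ _] := cK; apply: leq_ltn_trans le_K _.
  rewrite cardsD (setIidPr sSD) ltn_subrL !card_gt0 S0 /=.
  by apply: contraNneq S0 => D0; rewrite -subset0 -D0.
move=> [us ss [x [y [xm /bigcupP[l /andP[kl ne_lm] yl] p]]]].
have := short l s; rewrite -ltnS ltn_ord => /(_ isT kl ne_lm) h.
suff : 2 * size s + c <= 2 * size Q by lia.
by apply: h; split=> //; exists x, y.
Qed.

End Pieces.

(** * Choosing the positions of a longest ear to delete *)

Section LongestEars.
Context (T : finType) (e : rel T) (e_sym : symmetric e).
Context (V : {set T}) (eV : forall x y, e x y -> x \in V).
Implicit Types (A B D K L S W X Y : {set T}) (s Q : seq T).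

Definition longest_ear A B D Q :=
  ear e A B D Q /\ forall s, ear e A B D s -> size s <= size Q.

Lemma longest_ear_rev A B D Q : longest_ear A B D Q -> longest_ear B A D (rev Q).
Proof.
move=> [eQ maxQ]; split=> [|s es]; first exact: (ear_rev e_sym eQ).
rewrite size_rev -[size s]size_rev; apply: maxQ; exact: (ear_rev e_sym es).
Qed.

Lemma pieceC A B D : piece e V D A B -> piece e V D B A.
Proof. by case=> *; split=> //; rewrite [B :|: A]setUC. Qed.

Lemma ear_attached X Y K s : ear e X Y K s -> 0 < size s -> ~~ no_edge e K Y.
Proof.
move=> [_ sK [x [y [_ yY]]]]; case/lastP: s sK => // s z sK.
rewrite !rcons_path last_rcons => /andP[_ ezy] _.
by apply/no_edgePn; exists z, y; split; rewrite // sK // mem_rcons mem_head.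
Qed.

Lemma stop_edge A B D Q j : ear e A B D Q -> j <= size Q ->
  exists x y, [/\ x \in stop A B Q j, y \in stop A B Q j.+1 & e x y].
Proof.
move=> eQ le_jQ; have [|s [_ _ [x [y [xj yj p]]]] s0] :=
  ear_segment (j := j) (l := j.+1) eQ; first by rewrite ltnS leqnn.
move: s0 p; rewrite subSnn => /size0nil -> /= /andP[exy _].
by exists x, y.
Qed.

(* Every choice of a stop as one side and the remaining stops as the other side
   leaves an ear longer than half of [Q] in [K]. *)
Definition long_eared A B D Q K :=
  component e K (D :\: positions Q predT) /\
  forall m, m <= (size Q).+1 -> attached e A B Q K m -> exists l s,
    [/\ l <= (size Q).+1, l != m, ear e (stop A B Q m) (stop A B Q l) K s &
        size Q < 2 * size s].

(** The stops of value at most [i] are the two outer sides and the first and last [i] positions. *)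
Definition end_dist Q m := minn m ((size Q).+1 - m).

Lemma long_eared_rev A B D Q K : long_eared A B D Q K -> long_eared B A D (rev Q) K.
Proof.
move=> [cK bK]; split.
  suff -> : positions (rev Q) predT = positions Q predT by [].
  by apply/setP => x; rewrite !inE mem_rev.
move=> m; rewrite size_rev => le_m; rewrite /attached stop_rev // => am.
have [|l [s [le_l ne es lt]]] := bK ((size Q).+1 - m) _ am; first by lia.
exists ((size Q).+1 - l), s; rewrite !stop_rev; try by lia.
by rewrite subKn //; split=> //; lia.
Qed.

Lemma ear_between A B D Q K j l s : longest_ear A B D Q ->
  l <= (size Q).+1 -> j <= (size Q).+1 -> j != l -> K \subset D ->
  [disjoint K & positions Q (fun m => (m <= minn j l) || (maxn j l <= m))] ->
  ear e (stop A B Q j) (stop A B Q l) K s -> size s + minn j l < maxn j l.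
Proof.
move=> [eQ maxQ] le_l le_j ne sKD; case: (ltngtP j l) ne => // lt _ dis es.
  by apply: longest_splice eQ maxQ _ sKD dis es; rewrite lt.
rewrite -size_rev; apply: longest_splice eQ maxQ _ sKD dis _ => //.
  by rewrite lt.
exact: (ear_rev e_sym es).
Qed.

Lemma disjoint_positions Q P K : [disjoint K & positions Q predT] ->
  [disjoint K & positions Q P].
Proof. by move=> dis; apply: disjointWr dis; apply: positionsS. Qed.

Lemma component_disjoint K W S : component e K (W :\: S) -> [disjoint K & S].
Proof.
move=> [_ sK _ _]; rewrite disjoints_subset; apply: subset_trans sK _.
by rewrite setDE subsetIr.
Qed.

(** By maximality of [Q] the gap between stops [m] and [l] exceeds the length of the long ear, more
    than half of [Q]; less than half of [Q] is left between stop [m] and one end. *)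
Lemma long_eared_end_dist A B D Q K m : longest_ear A B D Q -> long_eared A B D Q K ->
  m <= (size Q).+1 -> attached e A B Q K m -> 2 * end_dist Q m < size Q.
Proof.
move=> lQ [cK bK] le_m am; have [l [s [le_l ne es lt]]] := bK m le_m am.
have [_ sK _ _] := cK.
have := ear_between lQ le_l le_m _ _ _ es.
rewrite eq_sym ne => /(_ isT (subset_trans sK (subsetDl _ _))).
move=> /(_ (disjoint_positions _ (component_disjoint cK))).
rewrite /end_dist; lia.
Qed.

Lemma card_positions_ends Q i : uniq Q -> i <= size Q ->
  #|positions Q (fun m => (m <= i) || ((size Q).+1 - i <= m))| <= 2 * i.
Proof.
move=> uQ le_iQ.
apply: (@leq_trans #|[set x in take i Q] :|: [set x in drop (size Q - i) Q]|).
  apply/subset_leq_card/subsetP => x; rewrite !inE => /andP[xQ].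
  rewrite in_take // => /orP[->//|le]; apply/orP; right.
  move: (xQ); rewrite -{1}(cat_take_drop (size Q - i) Q) mem_cat in_take //.
  by case/orP => // lt; move: le lt; move: (index x Q) => k; lia.
rewrite cardsU (leq_trans (leq_subr _ _)) // !cardsE.
have := card_size (take i Q); have := card_size (drop (size Q - i) Q).
by rewrite size_drop size_takel // subKn // mul2n -addnn => h1 h2; apply: leq_add.
Qed.

(* [K0] plays the detour: an ear from stop [i] down to a stop [l < i] through the
   middle component extends through [K0] to an ear from stop [l] to the far end. *)
Lemma eliminate_ends A B D Q K0 i : two_connected e V -> piece e V D A B ->
  longest_ear A B D Q -> smaller_pieces_bounded e V D ->
  0 < i -> 2 * i < size Q -> long_eared A B D Q K0 -> attached e A B Q K0 i ->
  (forall m, m <= (size Q).+1 -> attached e A B Q K0 m -> end_dist Q m <= i) ->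
  (forall K, long_eared A B D Q K -> exists m,
    [/\ m <= (size Q).+1, attached e A B Q K m & i <= end_dist Q m]) ->
  treedepth_le e D (2 * size Q).
Proof.
move=> tc pD lQ IH i0 lt_iQ [cK0 bK0] a0 far0 farbad.
have [eQ maxQ] := lQ; have [uQ sQ _] := eQ.
pose I := fun m => (m <= i) || ((size Q).+1 - i <= m).
have [|q Gq [qQ /(_ uQ) iq]] := @stop_position T A B Q i; first by lia.
have S0 : positions Q I != set0.
  by apply/set0Pn; exists q; rewrite inE qQ iq /I prednK // leqnn.
apply: (elimination_step e_sym eV tc pD eQ S0 (c := 2 * i)) => //.
- by apply: card_positions_ends => //; lia.
- by lia.
move=> K cK; have [_ sKW _ conK] := cK.
have disKS := component_disjoint cK.
have sKD : K \subset D := subset_trans sKW (subsetDl _ _).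
(* Either [K] also avoids the undeleted middle of [Q], and is a component of [D] minus all of [Q],
   or it contains a middle vertex [z]. *)
have [/pred0P disKQ|/pred0Pn[z /andP[zK zQ]]] :=
    boolP [disjoint K & positions Q (predC I)].
  have disK : [disjoint K & positions Q predT].
    rewrite disjoints_subset; apply/subsetP => x xK; rewrite !inE andbT.
    apply/negP => xQ; have := disKQ x; have := disjointFr disKS xK.
    by rewrite /= xK !inE xQ /= => ->.
  have cKQ : component e K (D :\: positions Q predT).
    case: cK => K0' _ nK _; split=> //.
      apply/subsetP => x xK; rewrite inE (subsetP sKD) // andbT.
      by rewrite (disjointFr disK xK).
    apply: no_edgeS (subxx _) _ nK; apply: setSD; apply: setDS.
    exact: positionsS.
  have keptK m : m <= (size Q).+1 -> attached e A B Q K m -> kept Q I m.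
    move=> le_m /no_edgePn[x [y [xK ym exy]]]; rewrite /kept.
    have [//|m0] := eqVneq m 0; have [//|mQ] := eqVneq m (size Q).+1.
    rewrite /=; apply: contraT => nIm.
    have [|p Gp [pQ /(_ uQ) ip]] := @stop_position T A B Q m.
      by rewrite lt0n m0 -ltnS ltn_neqAle mQ.
    have yp : y = p by move: ym; rewrite Gp inE => /eqP.
    have m_ip : (index p Q).+1 = m by rewrite ip prednK // lt0n.
    have pK : p \in K.
      rewrite -yp; apply: component_closed cK xK _ exy.
      by rewrite yp !inE pQ m_ip (negPf nIm) sQ.
    by have := disjointFr disK pK; rewrite !inE pQ.
  have bound m l s : m <= (size Q).+1 -> l <= (size Q).+1 -> l != m ->
      ear e (stop A B Q m) (stop A B Q l) K s -> size s + minn m l < maxn m l.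
    move=> le_m le_l ne es; apply: ear_between lQ le_l le_m _ sKD _ es.
      by rewrite eq_sym.
    exact: disjoint_positions.
  (* If [K] is long-eared, [farbad] gives a stop at distance at least [i] from both ends, and its
     gap to any other stop loses [i]. Otherwise some stop has only ears of at most half of [Q],
     which suffices since [2 * i < size Q]. *)
  have [/farbad[m [le_m am le_im]]|nbad] := pselect (long_eared A B D Q K).
    exists m; split=> [//||//|l s le_l _ ne /(bound m l s le_m le_l ne)].
      exact: keptK.
    by move: le_im; rewrite /end_dist; clear -le_l ne le_m; lia.
  apply: contrapT => nm; apply: nbad; split=> // m le_m am.
  apply: contrapT => nl; apply: nm; exists m; split=> //; first exact: keptK.
  move=> l s le_l _ ne es; rewrite leqNgt; apply/negP => lt; apply: nl.
  by exists l, s; split=> //; clear -lt lt_iQ; lia.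
have {}zQ : (z \in Q) && predC I (index z Q).+1.
  by have : z \in positions Q (predC I) := zQ; rewrite inE.
have sub t x : x \in stop A B Q t -> i < t < (size Q).+1 - i -> t <= size Q ->
    x \in D :\: positions Q I.
  move=> xt lt_t le_t; have [|p Gp [pQ /(_ uQ) ip]] := @stop_position T A B Q t.
    by clear -lt_t i0 le_t; lia.
  move: xt; rewrite Gp inE => /eqP->; rewrite !inE pQ ip sQ // andbT /I.
  by clear -lt_t; lia.
(* Going down [Q] from a middle vertex of [K], one stays in [K] until stop [i] is reached. *)
have aK t : i < t < (size Q).+1 - i -> stop A B Q t \subset K -> attached e A B Q K i.
  elim: t => [|t IHt] //= lt_t sK.
  have [|x [y [xt yt exy]]] := stop_edge (j := t) eQ; first by clear -lt_t i0; lia.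
  have yK := subsetP sK y yt.
  have [eq_ti|ne_ti] := eqVneq t i.
    by apply/no_edgePn; exists y, x; rewrite -eq_ti e_sym.
  apply: IHt; first by clear -ne_ti lt_t; lia.
  have xK : x \in K.
    apply: component_closed cK yK _ _; last by rewrite e_sym.
    by apply: (sub t) => //; clear -ne_ti lt_t i0; lia.
  have [|p Gp _] := @stop_position T A B Q t; first by clear -ne_ti lt_t i0; lia.
  by move: xt; rewrite Gp inE sub1set => /eqP <-.
have lt_z : i < (index z Q).+1 < (size Q).+1 - i.
  by move: zQ; rewrite /= /I => /andP[_]; move: (index z Q) => k; clear; lia.
have {aK}Ki : attached e A B Q K i.
  have /andP[zinQ _] := zQ.
  apply: aK lt_z _.
  by rewrite (stop_nth _ _ z) ?index_mem // nth_index // sub1set.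
have disK0Q := component_disjoint cK0.
have [_ sK0W _ _] := cK0.
have sK0D : K0 \subset D := subset_trans sK0W (subsetDl _ _).
(* Within [Q], [K0] is attached only to deleted positions, so [K :&: K0] is cut off in [K]; were it
   nonempty, [z] would lie in [K0]. *)
have disKK0 : [disjoint K & K0].
  rewrite -setI_eq0; apply: contraT => KK0.
  suff /setIidPl/subsetP/(_ z zK) zK0 : K :&: K0 = K.
    have := disjointFr disK0Q zK0; move: zQ.
    by rewrite !inE => /andP[->].
  apply: conK => //; first exact: subsetIl.
  apply/no_edgeP => x y; rewrite !inE => /andP[xK xK0] /andP[yKK0 yK].
  apply: contraNN yKK0 => exy; rewrite yK /=.
  apply: (component_closed cK0 xK0 _ exy); rewrite !inE (subsetP sKD) // !andbT.
  apply/negP => yQ; have := disjointFr disKS yK; rewrite inE yQ /= /I => /negP; apply.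
  have := far0 (index y Q).+1; rewrite ltnS index_size /end_dist => /(_ isT).
  have -> : attached e A B Q K0 (index y Q).+1.
    apply/no_edgePn; exists x, y; split=> //.
    by rewrite (stop_nth _ _ y) ?index_mem // nth_index // set11.
  by move=> /(_ isT); move: (index y Q) => k; clear; lia.
have le_iQ : i <= (size Q).+1 by clear -lt_iQ; lia.
(* The long ear of [K0] from stop [i] has more than [i] vertices, too many to end at an earlier
   stop; so [l0] is near the other end. *)
have [l0 [s0 [le_l0 ne0 es0 lt_s0]]] := bK0 i le_iQ a0.
have lt_il0 : i < l0.
  have := ear_between lQ le_l0 le_iQ _ sK0D (disjoint_positions _ disK0Q) es0.
  by rewrite eq_sym ne0 => /(_ isT); clear -lt_s0 lt_iQ ne0; lia.
have le_l0i : (size Q).+1 - i <= l0.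
  have := far0 l0 le_l0; rewrite /end_dist => /(_ (ear_attached es0 _)).
  by clear -lt_s0 lt_iQ lt_il0; lia.
(* An ear to a later kept stop loses [i] by maximality of [Q]. For one to an earlier stop, the
   detour [s0] takes more than half of [Q] and leaves less than half for [s]. *)
exists i; split=> // [|l s le_l kl ne es]; first by rewrite /kept /I leqnn !orbT.
have [lt_il|lt_li|eq_il] := ltngtP i l; last by rewrite eq_il eqxx in ne.
  have le_il : (size Q).+1 - i <= l.
    by move: kl; rewrite /kept /I; clear -lt_il i0; lia.
  have := ear_between lQ le_l le_iQ _ sKD _ es.
  rewrite eq_sym ne => /(_ isT) h.
  suff /h : [disjoint K & positions Q (fun m => (m <= minn i l) || (maxn i l <= m))].
    by clear -lt_il le_l; lia.
  apply: disjointWr disKS; apply: positionsS => m.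
  by rewrite /I; clear -lt_il le_il; lia.
have es1 := ear_rev e_sym es; rewrite Gq in es1 es0.
have qD := sQ q qQ.
have qS : q \in positions Q I by rewrite inE qQ iq prednK // /I leqnn.
have es2 : ear e (stop A B Q l) (stop A B Q l0) (K :|: (q |: K0)) (rev s ++ q :: s0).
  apply: ear_cat es1 es0 disKK0 _ _; first by rewrite (disjointFl disKS qS).
  by rewrite (disjointFl disK0Q) // inE qQ.
have := longest_splice eQ maxQ _ _ _ es2.
rewrite (ltn_trans lt_li lt_il0) le_l0 => /(_ isT).
rewrite !subUset sKD sK0D sub1set qD => /(_ isT) h.
suff /h : [disjoint K :|: (q |: K0) & positions Q (fun m => (m <= l) || (l0 <= m))].
  by rewrite size_cat size_rev /=; clear -lt_s0 le_l0 lt_iQ; lia.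
rewrite -!setI_eq0 !setIUl !setU_eq0 !setI_eq0; apply/and3P; split.
- apply: disjointWr disKS; apply: positionsS => m; rewrite /I.
  by clear -lt_li le_l0i; lia.
- by rewrite disjoints1 inE qQ iq prednK //; clear -lt_li lt_il0; lia.
- exact: disjoint_positions.
Qed.

Lemma piece_ear A B D : piece e V D A B -> exists s, ear e A B D s /\ 0 < size s.
Proof.
case=> _ cD _ _ /no_edgePn[x [a [xD aA exa]]] /no_edgePn[y [b [yD bB eyb]]].
have [p [pp lp up sp]] := connected_path cD xD yD.
exists (x :: p); split=> //; split=> //; exists a, b; split=> //.
by rewrite /= e_sym exa rcons_path pp lp.
Qed.

Lemma exists_longest_ear A B D s n : ear e A B D s ->
  (forall s, ear e A B D s -> size s <= n) -> exists Q, longest_ear A B D Q.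
Proof.
move=> es le_n; pose P m := `[< exists s, ear e A B D s /\ size s = m >].
have exP : exists m, P m by exists (size s); apply/asboolP; exists s.
have maxP m : P m -> m <= n by move=> /asboolP[s' [/le_n le <-]].
have [m /asboolP[Q [eQ sQ]] maxm] := ex_maxnP exP maxP.
exists Q; split=> // s' es'; rewrite sQ; apply: maxm.
by apply/asboolP; exists s'.
Qed.

Lemma treedepth_longest_ear A B D n : two_connected e V -> piece e V D A B ->
  (forall s, ear e A B D s -> size s <= n) -> treedepth_le e D (2 * n).
Proof.
move=> tc; have [d] := ubnP #|D|; elim: d => // d IHd in A B D n *.
rewrite ltnS => le_Dd pD le_n.
have {IHd le_Dd}IH : smaller_pieces_bounded e V D.
  by move=> K A' B' n' pK lt_K; apply: IHd pK; apply: leq_trans lt_K le_Dd.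
have [s [es s0]] := piece_ear pD.
have [Q lQ] := exists_longest_ear es le_n; have [eQ maxQ] := lQ.
have Q0 : 0 < size Q := leq_trans s0 (maxQ s es).
apply: (@treedepthW _ _ _ (2 * size Q)); first by rewrite leq_mul2l le_n.
have [uQ sQ _] := eQ.
have posQ : positions Q predT = [set x in Q] by apply/setP => x; rewrite !inE andbT.
have QS0 : positions Q predT != set0.
  case: (Q) Q0 => // q Q' _; apply/set0Pn; exists q.
  by rewrite !inE eqxx.
(* Without a long-eared component all of [Q] is deleted: [c] is [size Q], and ears of at most half
   of [Q] are short enough. *)
have [[K0 bK0]|nobad] := pselect (exists K, long_eared A B D Q K); last first.
  apply: (elimination_step e_sym eV tc pD eQ QS0 (c := size Q)) => //.
  - by rewrite posQ cardsE card_size.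
  - by rewrite leq_pmull.
  move=> K cK; apply: contrapT => nm; apply: nobad; exists K; split=> // m le_m am.
  apply: contrapT => nl; apply: nm; exists m; split=> //; first by rewrite /kept !orbT.
  move=> l s' le_l _ ne es'; rewrite leqNgt; apply/negP => lt; apply: nl.
  by exists l, s'; split=> //; clear -lt; lia.
pose P i := `[< exists K, long_eared A B D Q K /\ forall m, m <= (size Q).+1 ->
  attached e A B Q K m -> end_dist Q m <= i >].
have exP : exists i, P i.
  exists (size Q).+1; apply/asboolP; exists K0; split=> // m le_m _.
  by rewrite /end_dist geq_min le_m.
have [i /asboolP[K [bK farK]] mini] := ex_minnP exP.
have [cK _] := bK; have [K_neq0 sKW _ _] := cK.
have disKQ := component_disjoint cK.
(* With [i = 0] the component would have no neighbour in [Q] and so would be all of [D], which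
   contains [Q]. *)
have i0 : 0 < i.
  rewrite lt0n; apply: contra_neq QS0 => i_eq0.
  have KD : K = D.
    apply: (piece_connected pD) => //; first exact: subset_trans sKW (subsetDl _ _).
    apply/no_edgeP => x y xK; rewrite inE => /andP[yK yD]; apply/negP => exy.
    have yQ : y \in Q.
      apply: contraNT yK => yQ; apply: (component_closed cK xK _ exy).
      by rewrite !inE (negPf yQ).
    have := farK (index y Q).+1; rewrite ltnS index_size i_eq0 /end_dist => /(_ isT).
    have lt_y : index y Q < size Q by rewrite index_mem.
    have -> : attached e A B Q K (index y Q).+1.
      apply/no_edgePn; exists x, y; split=> //.
      by rewrite (stop_nth _ _ y) // nth_index // set11.
    by move=> /(_ isT); move: (index y Q) lt_y => t; clear; lia.
  rewrite posQ; apply/eqP; rewrite -subset0; apply/subsetP => x; rewrite inE => xQ.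
  have /(disjointFl disKQ) : x \in positions Q predT by rewrite posQ inE.
  by rewrite KD sQ.
(* Otherwise [i.-1] would contradict the minimality of [i]. *)
have far K' : long_eared A B D Q K' -> exists m,
    [/\ m <= (size Q).+1, attached e A B Q K' m & i <= end_dist Q m].
  move=> bK'; apply: contrapT => nm; suff : i <= i.-1 by lia.
  apply: mini; apply/asboolP; exists K'; split=> // m le_m am.
  by rewrite -ltnS prednK // ltnNge; apply/negP => le; apply: nm; exists m.
have [m [le_m am le_im]] := far K bK.
have eq_i : end_dist Q m = i by apply/eqP; rewrite eqn_leq le_im farK.
have lt_iQ : 2 * i < size Q by rewrite -eq_i; apply: long_eared_end_dist lQ bK le_m am.
(* A stop at distance [i] is stop [i] or its mirror image, which becomes stop [i] when [Q] is
   reversed. *)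
have [eq_m|ne_m] := eqVneq m i.
  by apply: (eliminate_ends tc pD lQ IH i0 lt_iQ bK) => //; rewrite -eq_m.
have eq_m : m = (size Q).+1 - i.
  by move: eq_i ne_m le_m; rewrite /end_dist; clear; lia.
have rev_dist k : k <= (size Q).+1 -> end_dist (rev Q) k = end_dist Q ((size Q).+1 - k).
  by rewrite /end_dist size_rev => le_k; rewrite subKn // minnC.
have rev_att K' k : k <= (size Q).+1 ->
    attached e B A (rev Q) K' k = attached e A B Q K' ((size Q).+1 - k).
  by move=> le_k; rewrite /attached stop_rev.
rewrite -(size_rev Q).
apply: (eliminate_ends tc (pieceC pD) (longest_ear_rev lQ) IH i0 _ (long_eared_rev bK)).
- by rewrite size_rev.
- by rewrite rev_att -?eq_m //; clear -lt_iQ; lia.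
- move=> k; rewrite size_rev => le_k; rewrite rev_att // rev_dist //.
  by apply: farK; rewrite leq_subr.
move=> K' /long_eared_rev; rewrite revK => /far[k [le_k ak le_ik]].
exists ((size Q).+1 - k); rewrite size_rev leq_subr.
by rewrite rev_att ?rev_dist ?leq_subr // subKn.
Qed.

End LongestEars.

(** * Critical graphs *)

Section CriticalGraphs.
Context (T : finType) (G : sgraph T).
Local Notation e := (adj G).
Local Notation V := (vset G).
Implicit Types (A B D K W X : {set T}).

Let e_sym : symmetric e := @adj_sym T G.

Lemma adj_vsetr x y : e x y -> y \in V.
Proof. by rewrite e_sym; apply: adj_vset. Qed.

Definition induced_adj W : rel T := [rel x y | [&& e x y, x \in W & y \in W]].

Lemma induced_adj_sym W : symmetric (induced_adj W).
Proof. by move=> x y; rewrite /induced_adj /= e_sym (andbC (x \in W)). Qed.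

Lemma induced_adj_irrefl W : irreflexive (induced_adj W).
Proof. by move=> x; rewrite /induced_adj /= adj_irrefl. Qed.

Lemma induced_adj_vset W x y : induced_adj W x y -> x \in W.
Proof. by case/and3P. Qed.

Definition induced W :=
  SGraph (@induced_adj_sym W) (@induced_adj_irrefl W) (@induced_adj_vset W).

Definition coloring_on q W (c : T -> nat) :=
  (forall x, x \in W -> c x < q) /\
  (forall x y, e x y -> x \in W -> y \in W -> c x <> c y).

Lemma critical_coloring_on k W :
  critical k G -> W \proper V -> exists c, coloring_on k.-1 W c.
Proof.
move=> [_ crit] /properP[sWV [x xV xW]].
have [|c [c_lt c_ne]] := crit (induced W).
  split; first by split=> // u v /and3P[].
  by case=> /subsetP/(_ x xV) /=; rewrite (negPf xW).
by exists c; split=> // u v euv uW vW; apply: c_ne; apply/and3P.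
Qed.

Lemma not_colorable_on q c : ~ colorable q G -> ~ coloring_on q V c.
Proof.
move=> ncol [c_lt c_ne]; apply: ncol; exists c; split=> // x y exy.
by apply: c_ne; rewrite // (adj_vset exy, adj_vsetr exy).
Qed.

(* Two colorings of the two sides of a cut vertex agree on it up to exchanging
   two colors, hence can be glued. *)
Lemma critical_two_connected k : critical k G -> two_connected e V.
Proof.
move=> crit K z sKV K0 zV zK nK; apply: contraT => nV.
have [w wV wzK] := subsetPn nV.
have zKV : z |: K \proper V.
  by rewrite properE subUset sub1set zV sKV nV.
have KV : V :\: K \proper V.
  rewrite properEneq subsetDl andbT; have [x xK] := set0Pn _ K0.
  by apply/eqP => /setP/(_ x); rewrite inE xK (subsetP sKV).
have [c1 [lt1 ne1]] := critical_coloring_on crit zKV.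
have [c2 [lt2 ne2]] := critical_coloring_on crit KV.
pose f n := if n == c1 z then c2 z else if n == c2 z then c1 z else n.
have f_inj : injective f.
  move=> m n; rewrite /f; do 4?case: eqP => //; congruence.
pose c x := if x \in K then f (c1 x) else c2 x.
have zVK : z \in V :\: K by rewrite inE zK zV.
have f_lt n : n < k.-1 -> f n < k.-1.
  move=> lt_n; rewrite /f; case: eqP => _; first exact: lt2.
  by case: eqP => // _; apply: lt1; rewrite setU11.
have out x y : x \in K -> y \notin K -> e x y -> c x <> c y.
  move=> xK yK exy; have yV := adj_vsetr exy.
  have yz : y = z.
    apply/eqP; apply: contraTT exy => yz; apply: (no_edgeP _ _ _ nK) => //.
    by rewrite !inE (negPf yz) (negPf yK).
  rewrite /c xK (negPf yK) yz => eq_c; rewrite {}yz in exy.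
  have : f (c1 x) = f (c1 z) by rewrite eq_c /f eqxx.
  by move/f_inj; apply: ne1; rewrite // !inE ?xK ?orbT ?eqxx.
case: (@not_colorable_on k.-1 c crit.1); split=> [x xV|x y exy xV yV].
  rewrite /c; case: ifPn => xK; last by apply: lt2; rewrite inE xK.
  by apply: f_lt; apply: lt1; rewrite setU1r.
have [xK|xK] := boolP (x \in K); have [yK|yK] := boolP (y \in K).
- rewrite /c xK yK => /f_inj; apply: ne1; rewrite // setU1r //.
- exact: out.
- by move=> /esym; apply: out; rewrite // e_sym.
- by rewrite /c (negPf xK) (negPf yK); apply: ne2; rewrite // inE ?xK ?yK.
Qed.

(* Colorings [c v] of [G - v] and [c w] of [G - w] that agree on [X] cannot have
   [v] and [w] in parts of [D] not joined by an edge: glued together they would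
   color [G]. So the vertices [v] sharing their coloring of [X] lie in one
   component of [D], and removing a vertex multiplies their number by at most
   the number of colors. *)
Lemma card_treedepth q (c : T -> T -> nat) D h : ~ colorable q G ->
  (forall v, v \in V -> coloring_on q (V :\ v) (c v)) ->
  treedepth_le e D h -> D \subset V ->
  forall X W (phi : T -> nat), no_edge e D (V :\: (D :|: X)) -> W \subset D ->
  (forall v x, v \in W -> x \in X -> c v x = phi x) -> [disjoint D & X] ->
  #|W| <= q.+1 ^ h.
Proof.
move=> ncol col; elim=> {D h}
  [h|D1 D2 h disD nD _ IH1 _ IH2|p D h pD _ IH] sDV X W phi nX sWD agree dX.
- by move: sWD; rewrite subset0 => /eqP->; rewrite cards0.
- have [sD1 sD2] : D1 \subset V /\ D2 \subset V by apply/andP; rewrite -subUset.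
  have [d1 d2] : [disjoint D1 & X] /\ [disjoint D2 & X].
    by split; apply: disjointWl dX; rewrite (subsetUl, subsetUr).
  have bd x y : x \in D1 -> y \notin D1 -> e x y -> y \in X.
    move=> xD yD exy; apply: contraTT exy => yX.
    have [yD2|yD2] := boolP (y \in D2); first exact: (no_edgeP _ _ _ nD).
    apply/negP => exy; have := no_edgeP _ _ _ nX x y.
    rewrite exy !inE xD (negPf yD) (negPf yD2) (negPf yX) (adj_vsetr exy).
    by move=> /(_ isT isT).
  have bd2 x y : x \in D2 -> y \notin D2 -> e x y -> y \in X.
    move=> xD yD exy; apply: contraTT exy => yX.
    have [yD1|yD1] := boolP (y \in D1).
      by rewrite e_sym; apply: (no_edgeP _ _ _ nD).
    apply/negP => exy; have := no_edgeP _ _ _ nX x y.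
    rewrite exy !inE xD (negPf yD) (negPf yD1) (negPf yX) (adj_vsetr exy) orbT.
    by move=> /(_ isT isT).
  have nX1 : no_edge e D1 (V :\: (D1 :|: X)).
    apply/no_edgeP => x y xD; rewrite !inE negb_or => /andP[/andP[yD yX] _].
    by apply: contraNN yX; apply: bd.
  have nX2 : no_edge e D2 (V :\: (D2 :|: X)).
    apply/no_edgeP => x y xD; rewrite !inE negb_or => /andP[/andP[yD yX] _].
    by apply: contraNN yX; apply: bd2.
  have [W1|/subsetPn[v vW vD1]] := boolP (W \subset D1).
    exact: IH1 nX1 W1 agree d1.
  have [W2|/subsetPn[w wW wD2]] := boolP (W \subset D2).
    exact: IH2 nX2 W2 agree d2.
  have vD2 : v \in D2 by have := subsetP sWD v vW; rewrite inE (negPf vD1).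
  have wD1 : w \in D1.
    by have := subsetP sWD w wW; rewrite inE (negPf wD2) orbF.
  have [vV wV] := (subsetP sD2 v vD2, subsetP sD1 w wD1).
  have [[ltv nev] [ltw new]] := (col v vV, col w wV).
  (* As [v] lies in [D2] and [w] in [D1], each coloring is used away from the vertex it omits. Edges
     leaving [D1] end in [X], where the two colorings agree. *)
  pose g x := if x \in D1 then c v x else c w x.
  have vwD x : (x \in D1 -> x != v) /\ (x \notin D1 -> x != w).
    by split=> xD; apply: contraTneq xD => ->; rewrite ?vD1 ?negbK.
  have gout x y : x \in D1 -> y \notin D1 -> e x y -> g x <> g y.
    move=> xD yD exy; have yX := bd x y xD yD exy.
    rewrite /g xD (negPf yD) (agree w y wW yX) -(agree v y vW yX).
    apply: nev => //; rewrite !inE ?(adj_vset exy) ?(adj_vsetr exy) andbT.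
      by apply: (vwD x).1.
    by apply: contraTneq yX => ->; rewrite (disjointFr d2 vD2).
  case: (@not_colorable_on q g ncol); split=> [x xV|x y exy xV yV].
    have [xv xw] := vwD x; rewrite /g; case: ifPn => xD.
      by apply: ltv; rewrite !inE xv.
    by apply: ltw; rewrite !inE xw.
  have [[xv xw] [yv yw]] := (vwD x, vwD y).
  have [xD|xD] := boolP (x \in D1); have [yD|yD] := boolP (y \in D1).
  + by rewrite /g xD yD; apply: nev; rewrite // !inE ?xv ?yv.
  + exact: gout.
  + by move=> /esym; apply: gout; rewrite // e_sym.
  + by rewrite /g (negPf xD) (negPf yD); apply: new; rewrite // !inE ?xw ?yw.
have pV := subsetP sDV p pD.
(* Within a class the colorings also agree on [p], which therefore moves from [D] to [X]. The vertex
   [p] itself, omitted by its own coloring, is counted apart: [1 + q * q.+1 ^ h <= q.+1 ^ h.+1]. *)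
pose Wc (a : 'I_q) := [set v in W :\ p | c v p == a].
have sW : W \subset p |: \bigcup_(a < q) Wc a.
  apply/subsetP => v vW; rewrite in_setU1; have [//|vp] := eqVneq v p.
  have vV := subsetP sDV v (subsetP sWD v vW).
  have lt_c : c v p < q by apply: (col v vV).1; rewrite !inE eq_sym vp.
  by apply/bigcupP; exists (Ordinal lt_c); rewrite // !inE vp vW /=.
have card_Wc a : #|Wc a| <= q.+1 ^ h.
  apply: (IH _ (p |: X) _ (fun x => if x == p then a : nat else phi x)).
  - by apply: subset_trans (subsetDl _ _) sDV.
  - apply: no_edgeS nX; first exact: subsetDl.
    apply/subsetP => x; rewrite !inE; by case: eqP => [->|_] //=; rewrite ?orbT.
  - apply/subsetP => v; rewrite !inE => /andP[/andP[-> vW] _].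
    exact: subsetP sWD v vW.
  - move=> v x; rewrite !inE => /andP[/andP[_ vW] /eqP cvp].
    by case: eqP => [->|_] //= xX; apply: agree.
  - rewrite disjoint_sym -setI_eq0 setIUl setU_eq0 !setI_eq0 disjoints1 !inE eqxx /=.
    by rewrite disjoint_sym; apply: disjointWl dX; apply: subsetDl.
apply: leq_trans (subset_leq_card sW) _; rewrite cardsU1.
apply: leq_trans (_ : 1 + q * q.+1 ^ h <= _); last first.
  by rewrite expnS mulSn leq_add2r expn_gt0.
apply: leq_add; first by case: (_ \notin _).
apply: leq_trans (_ : \sum_(a < q) #|Wc a| <= _).
  elim/big_rec2: _ => [|a m A _ le_A]; first by rewrite cards0.
  by rewrite cardsU (leq_trans (leq_subr _ _)) // leq_add2l.
rewrite -[X in X * _](card_ord q) -sum_nat_const; exact: leq_sum.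
Qed.

(** With [X] empty there is nothing to agree on, so [W] can be the whole vertex set. *)
Lemma critical_card_treedepth k h : 0 < k -> critical k G ->
  treedepth_le e V h -> #|V| <= k ^ h.
Proof.
move=> k0 crit tV.
have /fin_all_exists[c col] : forall v, exists c,
    v \in V -> coloring_on k.-1 (V :\ v) c.
  move=> v; have [vV|_] := boolP (v \in V); last by exists (fun=> 0).
  have [c cc] : exists c, coloring_on k.-1 (V :\ v) c.
    by apply: critical_coloring_on crit _; rewrite properD1.
  by exists c.
suff : #|V| <= k.-1.+1 ^ h by rewrite prednK.
apply: (card_treedepth crit.1 col tV (subxx _) (X := set0) (phi := fun=> 0)) => //.
- by apply/no_edgeP => x y _; rewrite setU0 setDv inE.
- by move=> v x _; rewrite inE.
- by rewrite -setI_eq0 setI0.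
Qed.

(** An edge [u v] closes a longest ear [Q] between its ends into a cycle of length [size Q + 2].
    Deleting [u] and [v] costs two levels, and [2 * size Q + 2] is at most twice this length. *)
Lemma critical_long_cycle k : 1 < k -> 2 < #|V| -> critical k G ->
  exists2 s, graph_cycle G s & #|V| <= k ^ (2 * size s).
Proof.
move=> k1 V2 crit; have tc := critical_two_connected crit.
have [u [v euv]] : exists u v, e u v.
  apply: contrapT => noe; case: crit => + _; apply; exists (fun=> 0).
  split=> [x _|x y exy]; first by lia.
  by case: noe; exists x, y.
have [uV vV] := (adj_vset euv, adj_vsetr euv).
have uv : u != v by apply: contraTneq euv => ->; rewrite adj_irrefl.
pose D := V :\: [set u; v].
have sD : [set u; v] \subset V by rewrite subUset !sub1set uV vV.
have D0 : D != set0.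
  by rewrite -card_gt0 cardsD (setIidPr sD) cards2 uv subn_gt0.
have pieceK K : component e K D -> piece e V K [set u] [set v].
  move=> [K0 sK nK cK]; have sKV := subset_trans sK (subsetDl _ _).
  have notK w : w \in [set u; v] -> w \notin K.
    by move=> wuv; apply/negP => /(subsetP sK); rewrite inE wuv.
  have bd : no_edge e K (V :\: (K :|: [set u; v])).
    by apply: no_edgeS nK => //; rewrite /D setUC setDDl.
  (* If [K] had no neighbour [w], then [w'] would be a cut vertex separating [K] from [w]. *)
  have nope w w' : w \in [set u; v] -> w' \in [set u; v] -> w != w' ->
      [set u; v] = [set w; w'] -> ~~ no_edge e K [set w].
    move=> wuv w'uv ww' eq_uv; apply/negP => nw.
    have : V \subset w' |: K.
      apply: tc => //; [exact: (subsetP sD) | exact: notK |].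
      apply/no_edgeP => x y xK; rewrite !inE negb_or => /andP[/andP[yw' yK] yV].
      have [->|yw] := eqVneq y w; first by apply: (no_edgeP _ _ _ nw); rewrite ?set11.
      by apply: (no_edgeP _ _ _ bd); rewrite // eq_uv !inE !negb_or yK yw yw' yV.
    move=> /subsetP/(_ w (subsetP sD w wuv)).
    by rewrite !inE (negPf ww') (negPf (notK w wuv)).
  split=> //.
  - rewrite disjoint_sym disjoints_subset; apply/subsetP => w /notK.
    by rewrite inE.
  - exact: (nope u v (set21 _ _) (set22 _ _) uv erefl).
  - by apply: (nope v u (set22 _ _) (set21 _ _) _ (setUC _ _)); rewrite eq_sym.
have [K0 cK0] := exists_component e D0.
have [s [es s0]] := piece_ear e_sym (pieceK K0 cK0).
have [_ sK0 _ _] := cK0.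
(* [Q] is longest in all of [D], so it bounds the ears of every component at once. *)
have [||Q [eQ maxQ]] := @exists_longest_ear _ e [set u] [set v] D s #|D| _ _.
- exact: earS es.
- move=> s' [us' ss' _]; rewrite -(card_uniqP us') subset_leq_card //.
  by apply/subsetP.
have Q0 : 0 < size Q by apply: leq_trans s0 (maxQ s _); apply: earS es.
exists (u :: rcons Q v).
  have [uQ sQ [_ [_ [/set1P-> /set1P-> pQ]]]] := eQ.
  have notQ w : w \in [set u; v] -> w \notin Q.
    by move=> wuv; apply/negP => /sQ; rewrite inE wuv.
  split; first by rewrite /= size_rcons; lia.
  apply/andP; split; first by rewrite /= rcons_path pQ last_rcons e_sym.
  rewrite /= rcons_uniq mem_rcons inE negb_or uv uQ andbT /=.
  by rewrite !notQ // !inE eqxx ?orbT.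
have tD : treedepth_le e D (2 * size Q).
  apply: treedepth_components => // K cK.
  apply: (treedepth_longest_ear e_sym _ tc (pieceK K cK)) => [x y|s' es'].
    exact: adj_vset.
  by apply: maxQ; have [_ sK _ _] := cK; apply: earS es'.
have tV : treedepth_le e V (2 * size Q + 2).
  by have := treedepthD sD tD; rewrite cards2 uv.
apply: leq_trans (critical_card_treedepth _ crit tV) _; first by lia.
by rewrite leq_exp2l //= size_rcons; lia.
Qed.

End CriticalGraphs.

(** * The bound in logarithmic form *)

Import Order.TTheory GRing.Theory Num.Theory.
Local Open Scope ring_scope.

Theorem theorem1p1 (R : realType) (k n : nat) (hk : (4 <= k)%N)
    (hn : (k + 2 <= n)%N) (T : finType) (G : sgraph T)
    (hG : #|vset G| = n) (hcrit : critical k G) :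
  exists s : seq T,
    graph_cycle G s /\
    ln (n%:R : R) / (100 * ln (k%:R : R)) <= (size s)%:R.
Proof.
have [||s cs le_n] := @critical_long_cycle T G k _ _ hcrit; [lia|rewrite hG; lia|].
exists s; split=> //; rewrite hG in le_n.
have k1 : 1 < k%:R :> R by rewrite ltr1n; lia.
have lnk : 0 < ln (k%:R : R) by rewrite ln_gt0.
rewrite ler_pdivrMr ?mulr_gt0 // mulrA mulrAC.
have : ln (n%:R : R) <= ln ((k ^ (2 * size s))%:R : R).
  by rewrite ler_ln ?posrE ?ltr0n ?ler_nat // ?expn_gt0; lia.
rewrite natrX lnXn ?ltr0n; last by lia.
move=> /le_trans; apply.
(* The factor 2 from the exponent is absorbed by the constant 100. *)
rewrite -[leLHS]mulr_natl natrM -mulrA [leRHS]mulrC.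
by apply: ler_wpM2r; rewrite ?ler_nat // mulr_ge0 // ltW.
Qed.
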